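(* Let $a_{11},a_{12},a_{21},a_{22},b\in\mathbb R$ and $$f(\mathbf x,\mathbf y)=a_{11}x_1^2y_1^2+a_{12}x_1^2y_2^2+a_{21}x_2^2y_1^2+a_{22}x_2^2y_2^2-b\,x_1x_2y_1y_2,$$ where $\mathbf x=(x_1,x_2)^\top$, $\mathbf y=(y_1,y_2)^\top$. Then the following three statements are equivalent: (a) $f(\mathbf x,\mathbf y)$ is PSD. (b) $f(\mathbf x,\mathbf y)$ is SOS. (c) $a_{11},a_{12},a_{21},a_{22}\ge 0$ and $\sqrt{a_{11}a_{22}}+\sqrt{a_{12}a_{21}}\ge \dfrac{|b|}{2}$.
   Context: A real polynomial is PSD if it takes nonnegative values at all real points; it is SOS if it is a finite sum of squares of real polynomials. *)

(* Defs.v *)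
From HB Require Import structures.
From mathcomp Require Import all_boot all_order all_algebra.
From mathcomp Require Import mpoly reals.
Set Implicit Arguments.
Unset Strict Implicit.
Unset Printing Implicit Defensive.

Import Order.TTheory GRing.Theory Num.Theory.
Local Open Scope ring_scope.

Definition psd (R : realType) (n : nat) (p : {mpoly R[n]}) : Prop :=
  forall v : 'I_n -> R, 0 <= p.@[v].

Definition sos (R : realType) (n : nat) (p : {mpoly R[n]}) : Prop :=
  exists s : seq {mpoly R[n]}, p = \sum_(q <- s) q ^+ 2.

(* The indeterminates 0, 1, 2, 3 stand for x1, x2, y1, y2. *)
Definition biquadratic (R : realType) (a11 a12 a21 a22 b : R) : {mpoly R[4]} :=
  let x1 : {mpoly R[4]} := 'X_(@Ordinal 4 0 isT) in
  let x2 : {mpoly R[4]} := 'X_(@Ordinal 4 1 isT) in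
  let y1 : {mpoly R[4]} := 'X_(@Ordinal 4 2 isT) in
  let y2 : {mpoly R[4]} := 'X_(@Ordinal 4 3 isT) in
  a11 *: (x1 ^+ 2 * y1 ^+ 2) + a12 *: (x1 ^+ 2 * y2 ^+ 2)
  + a21 *: (x2 ^+ 2 * y1 ^+ 2) + a22 *: (x2 ^+ 2 * y2 ^+ 2)
  - b *: (x1 * x2 * y1 * y2).

(* Main.v *)
(** A nonnegative binary quadratic form has its cross term bounded by twice the
    geometric mean of its diagonal coefficients, even if it is only nonnegative
    on the quadrant.  For fixed x, f is such a form in y; the bound obtained says
    that a binary quadratic form in x1^2, x2^2 is nonnegative on the quadrant, so
    the same bound applies again and yields
    b^2 <= 4 (sqrt (a11 a22) + sqrt (a12 a21))^2.
    Conversely, for l := b / (2 (sqrt (a11 a22) + sqrt (a12 a21))) one has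
    |l| <= 1, and f is the sum of
    (sqrt a11 x1 y1 - l sqrt a22 x2 y2)^2, (1 - l^2) a22 x2^2 y2^2 and the
    analogous pair for a12, a21. *)
Require Import Defs.
From HB Require Import structures.
From mathcomp Require Import all_boot all_order all_algebra.
From mathcomp Require Import mpoly reals.
From mathcomp Require Import ring lra.
Set Implicit Arguments.
Unset Strict Implicit.
Unset Printing Implicit Defensive.

Import Order.TTheory GRing.Theory Num.Theory.
Local Open Scope ring_scope.

Lemma cross_term_le_sqrt (R : rcfType) (a c t : R) :
  0 <= a -> 0 <= c ->
  (forall u v, 0 <= u -> 0 <= v -> t * (u * v) <= a * u ^+ 2 + c * v ^+ 2) ->
  t <= 2 * Num.sqrt (a * c).
Proof.
move=> a0 c0 H; case: (lerP t 0) => [t0|t0].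
  by apply: le_trans t0 _; rewrite mulr_ge0 ?sqrtr_ge0.
have t2 : 0 < t ^+ 2 by rewrite exprn_gt0.
have {}a0 : 0 < a.
  rewrite lt0r a0 andbT; apply/eqP => a_eq0.
  (* If [a = 0], the point [(c + 1, t)] gives [(c + 1) * t ^+ 2 <= c * t ^+ 2], which is impossible
     for [t > 0]; the case [c = 0] is symmetric. *)
  have := H (c + 1) t (addr_ge0 c0 ler01) (ltW t0); rewrite a_eq0; nra.
have {}c0 : 0 < c.
  rewrite lt0r c0 andbT; apply/eqP => c_eq0.
  have := H t (a + 1) (ltW t0) (addr_ge0 (ltW a0) ler01); rewrite c_eq0; nra.
(* At [u = sqrt c], [v = sqrt a] both squares contribute [a * c], so [t * s <= 2 * s ^+ 2] with
   [s = sqrt (a * c)]; then [s > 0] cancels. *)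
have := H _ _ (sqrtr_ge0 c) (sqrtr_ge0 a).
rewrite !sqr_sqrtr ?(ltW a0) ?(ltW c0) // -sqrtrM ?(ltW c0) // [c * a]mulrC.
have ac0 : 0 < Num.sqrt (a * c) by rewrite sqrtr_gt0 mulr_gt0.
have := sqr_sqrtr (ltW (mulr_gt0 a0 c0)).
set s := Num.sqrt _ in ac0 * => sE le_ts.
rewrite -(ler_pM2r ac0); nra.
Qed.

Lemma biquadratic_cross_term_le (R : rcfType) (a11 a12 a21 a22 b : R) :
  0 <= a11 -> 0 <= a12 -> 0 <= a21 -> 0 <= a22 -> 0 <= b ->
  (forall x1 x2 y1 y2, 0 <= x1 -> 0 <= x2 -> 0 <= y1 -> 0 <= y2 ->
     b * (x1 * x2 * y1 * y2) <=
     a11 * (x1 ^+ 2 * y1 ^+ 2) + a12 * (x1 ^+ 2 * y2 ^+ 2)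
     + a21 * (x2 ^+ 2 * y1 ^+ 2) + a22 * (x2 ^+ 2 * y2 ^+ 2)) ->
  b / 2 <= Num.sqrt (a11 * a22) + Num.sqrt (a12 * a21).
Proof.
move=> h11 h12 h21 h22 hb H.
(* With [x1 = sqrt X] and [x2 = sqrt Y], the form in y has diagonal [p], [q]; this is
   [b ^+ 2 * (X * Y) <= 4 * (p * q)] expanded, with the [X * Y] terms collected on the left. *)
have discr X Y : 0 <= X -> 0 <= Y ->
    (b ^+ 2 - 4 * (a11 * a22 + a12 * a21)) * (X * Y) <=
    4 * (a11 * a12) * X ^+ 2 + 4 * (a21 * a22) * Y ^+ 2.
  move=> X0 Y0.
  set p := a11 * X + a21 * Y; set q := a12 * X + a22 * Y.
  have p0 : 0 <= p by rewrite addr_ge0 ?mulr_ge0.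
  have q0 : 0 <= q by rewrite addr_ge0 ?mulr_ge0.
  have xy0 : 0 <= b * (Num.sqrt X * Num.sqrt Y).
    by rewrite !mulr_ge0 ?sqrtr_ge0.
  have le_pq : b * (Num.sqrt X * Num.sqrt Y) <= 2 * Num.sqrt (p * q).
    apply: cross_term_le_sqrt => // u v u0 v0.
    have := H _ _ _ _ (sqrtr_ge0 X) (sqrtr_ge0 Y) u0 v0.
    by rewrite !sqr_sqrtr // /p /q; lra.
  have pq0 : 0 <= 2 * Num.sqrt (p * q) := le_trans xy0 le_pq.
  move: le_pq; rewrite -ler_sqr ?nnegrE // !exprMn.
  rewrite !sqr_sqrtr ?mulr_ge0 // /p /q; lra.
have := cross_term_le_sqrt _ _ discr.
rewrite !mulr_ge0 // => /(_ isT isT).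
set s := Num.sqrt (a11 * a22); set t := Num.sqrt (a12 * a21).
have s0 : 0 <= s := sqrtr_ge0 _.
have t0 : 0 <= t := sqrtr_ge0 _.
have sE : s ^+ 2 = a11 * a22 by rewrite sqr_sqrtr ?mulr_ge0.
have tE : t ^+ 2 = a12 * a21 by rewrite sqr_sqrtr ?mulr_ge0.
(* The root thus becomes [4 * (s * t)], and the bound completes a square:
   [b ^+ 2 <= 4 * (s + t) ^+ 2]. *)
have -> : 4 * (a11 * a12) * (4 * (a21 * a22)) = (4 * (s * t)) ^+ 2.
  by rewrite !exprMn sE tE; ring.
rewrite sqrtr_sqr ger0_norm ?mulr_ge0 // -sE -tE => le_b.
rewrite ler_pdivrMr // -ler_sqr ?nnegrE ?mulr_ge0 ?addr_ge0 //; nra.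
Qed.

Lemma biquadratic_sos (R : realType) (a11 a12 a21 a22 b : R) :
  0 <= a11 -> 0 <= a12 -> 0 <= a21 -> 0 <= a22 ->
  `|b| / 2 <= Num.sqrt (a11 * a22) + Num.sqrt (a12 * a21) ->
  sos (biquadratic a11 a12 a21 a22 b).
Proof.
move=> h11 h12 h21 h22; rewrite !sqrtrM //.
set p11 := Num.sqrt a11; set p12 := Num.sqrt a12.
set p21 := Num.sqrt a21; set p22 := Num.sqrt a22.
have E11 : a11 = p11 ^+ 2 by rewrite sqr_sqrtr.
have E12 : a12 = p12 ^+ 2 by rewrite sqr_sqrtr.
have E21 : a21 = p21 ^+ 2 by rewrite sqr_sqrtr.
have E22 : a22 = p22 ^+ 2 by rewrite sqr_sqrtr.
set w := p11 * p22 + p12 * p21 => hb.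
have w0 : 0 <= w by rewrite addr_ge0 ?mulr_ge0 ?sqrtr_ge0.
have [l lb l1] : exists2 l, b = 2 * l * w & l ^+ 2 <= 1.
  have [w_eq0|w_neq0] := eqVneq w 0.
    (* Here the quotient defining [l] degenerates, but [w = 0] forces [b = 0]. *)
    exists 0; last by rewrite expr0n ler01.
    apply/eqP; rewrite mulr0 mul0r -normr_le0; move: hb; rewrite w_eq0; lra.
  exists (b / (2 * w)); first by field.
  have w_gt0 : 0 < w by rewrite lt0r w_neq0.
  rewrite -real_normK ?num_real // expr_le1 // normrM normfV.
  rewrite [`|2 * w|]ger0_norm ?mulr_ge0 // ler_pdivrMr ?mulr_gt0 //; lra.
set m := Num.sqrt (1 - l ^+ 2).
have mE : m ^+ 2 = 1 - l ^+ 2 by rewrite sqr_sqrtr ?subr_ge0.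
pose x1 : {mpoly R[4]} := 'X_(@Ordinal 4 0 isT).
pose x2 : {mpoly R[4]} := 'X_(@Ordinal 4 1 isT).
pose y1 : {mpoly R[4]} := 'X_(@Ordinal 4 2 isT).
pose y2 : {mpoly R[4]} := 'X_(@Ordinal 4 3 isT).
exists [:: p11%:MP * (x1 * y1) - (l * p22)%:MP * (x2 * y2);
           (m * p22)%:MP * (x2 * y2);
           p12%:MP * (x1 * y2) - (l * p21)%:MP * (x2 * y1);
           (m * p21)%:MP * (x2 * y1)].
rewrite !big_cons big_nil /biquadratic -/x1 -/x2 -/y1 -/y2 -!mul_mpolyC.
(* This relation merges the [l] and [m] squares of each pair; the two cross terms add up to
   [- 2 * l * w = - b]. *)
have mPE : m%:MP ^+ 2 = 1 - l%:MP ^+ 2 :> {mpoly R[4]}.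
  by rewrite !expr2 -!mpolyCM -!expr2 mE mpolyCB mpolyC1.
rewrite E11 E12 E21 E22 lb /w !(mpolyCM, mpolyCD, mpolyC1).
ring: mPE.
Qed.

Lemma biquadratic_psdP (R : realType) (a11 a12 a21 a22 b : R) :
  psd (biquadratic a11 a12 a21 a22 b) ->
  forall x1 x2 y1 y2,
    0 <= a11 * (x1 ^+ 2 * y1 ^+ 2) + a12 * (x1 ^+ 2 * y2 ^+ 2)
         + a21 * (x2 ^+ 2 * y1 ^+ 2) + a22 * (x2 ^+ 2 * y2 ^+ 2)
         - b * (x1 * x2 * y1 * y2).
Proof.
move=> H x1 x2 y1 y2.
have := H (fun i => nth 0 [:: x1; x2; y1; y2] i).
by rewrite /biquadratic !(mevalB, mevalD, mevalZ, mevalM, rmorphXn, mevalXU).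
Qed.

Lemma sos_psd (R : realType) (n : nat) (p : {mpoly R[n]}) : sos p -> psd p.
Proof.
move=> [s ->] v; rewrite raddf_sum sumr_ge0 // => q _.
by rewrite /= expr2 mevalM -expr2 sqr_ge0.
Qed.

Lemma biquadratic_psd_coef (R : realType) (a11 a12 a21 a22 b : R) :
  psd (biquadratic a11 a12 a21 a22 b) ->
  [/\ 0 <= a11, 0 <= a12, 0 <= a21, 0 <= a22 &
      `|b| / 2 <= Num.sqrt (a11 * a22) + Num.sqrt (a12 * a21)].
Proof.
move=> /biquadratic_psdP H.
have h11 : 0 <= a11 by have := H 1 0 1 0; lra.
have h12 : 0 <= a12 by have := H 1 0 0 1; lra.
have h21 : 0 <= a21 by have := H 0 1 1 0; lra.
have h22 : 0 <= a22 by have := H 0 1 0 1; lra.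
split=> //; apply: biquadratic_cross_term_le => // x1 x2 y1 y2 _ _ _ _.
(* Negating [x2] flips only the cross term, so the inequality holds for both signs of [b], hence for
   its absolute value. *)
have := H x1 x2 y1 y2; have := H x1 (- x2) y1 y2.
by case: (ger0P b) => _; lra.
Qed.

Theorem theorem4p5 (R : realType) (a11 a12 a21 a22 b : R) :
  let f := biquadratic a11 a12 a21 a22 b in
  let c := [/\ 0 <= a11, 0 <= a12, 0 <= a21, 0 <= a22 &
               `|b| / 2 <= Num.sqrt (a11 * a22) + Num.sqrt (a12 * a21)] in
  (psd f <-> sos f) /\ (sos f <-> c).
Proof.
move=> f c.
have sosc : c -> sos f by case; exact: biquadratic_sos.
have psdc : psd f -> c by exact: biquadratic_psd_coef.
split; split=> [h|h]; [exact/sosc/psdc | exact: sos_psd | | exact: sosc].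
exact/psdc/sos_psd.
Qed.
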